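(* Let $\Delta$ be a finite reduced root system. For $\mathbf{s}\in\mathcal{S}$, $\mathbf{y}\in V$ and $w\in\mathrm{Aut}(\Delta)$, if $s_\alpha\in\mathbb{Z}$ for all $\alpha\in\Delta_{w^{-1}}$, then $$(wS)(\mathbf{s},\mathbf{y};\Delta)=\Bigl(\prod_{\alpha\in\Delta_{w^{-1}}}(-1)^{-s_\alpha}\Bigr)S(\mathbf{s},\mathbf{y};\Delta).$$
   Context: $V$ is an $r$-dimensional real inner product space, $V^*$ identified with $V$; $\Delta\subset V$ is a finite reduced root system with fundamental system $\{\alpha_1,\dots,\alpha_r\}$, positive/negative roots $\Delta_\pm$, coroots $\alpha^\vee$; fundamental weights satisfy $\langle\alpha_i^\vee,\lambda_j\rangle=\delta_{ij}$, $P=\bigoplus_i\mathbb{Z}\lambda_i$. $\mathrm{Aut}(\Delta)\subset\mathrm{GL}(V)$ is the group of linear automorphisms stabilizing $\Delta$; the inner product is assumed $\mathrm{Aut}(\Delta)$-invariant (automatic when $\Delta$ is irreducible). For $w\in\mathrm{Aut}(\Delta)$, $\Delta_w=\Delta_+\cap w^{-1}\Delta_-$. $\mathbf{s}=(s_\alpha)$ is indexed by $\Delta/\{\pm1\}$ (so $s_{-\alpha}=s_\alpha$), with action $(w\mathbf{s})_\alpha=s_{w^{-1}\alpha}$; $\mathcal{S}=\{\mathbf{s}\in\mathbb{C}^{|\Delta_+|}:\Re s_\alpha>1\ \forall\alpha\in\Delta_+\}$. For a function $f(\mathbf{s},\mathbf{y})$, $(wf)(\mathbf{s},\mathbf{y})=f(w^{-1}\mathbf{s},w^{-1}\mathbf{y})$.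 Finally $$S(\mathbf{s},\mathbf{y};\Delta)=\sum_{\lambda\in P\setminus H_{\Delta^\vee}}e^{2\pi\sqrt{-1}\langle\mathbf{y},\lambda\rangle}\prod_{\alpha\in\Delta_+}\frac1{\langle\alpha^\vee,\lambda\rangle^{s_\alpha}},\qquad H_{\Delta^\vee}=\{\lambda\in P:\langle\alpha^\vee,\lambda\rangle=0\text{ for some }\alpha\in\Delta\},$$ which converges absolutely on $\mathcal{S}\times V$; complex powers of negative reals use one fixed branch (e.g. $\arg=\pi$). *)

(* Defs.v *)
From HB Require Import structures.
From mathcomp Require Import all_boot all_order all_algebra sesquilinear complex.
From mathcomp Require Import all_classical all_reals all_analysis.
From mathcomp.analysis.showcase Require summability.

Set Implicit Arguments.
Unset Strict Implicit.
Unset Printing Implicit Defensive.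

Import Order.TTheory GRing.Theory Num.Theory.
Import numFieldNormedType.Exports.

Local Open Scope classical_set_scope.
Local Open Scope complex_scope.
Local Open Scope ring_scope.

(* The inner product [ip] identifies the dual of V with V, so that coroots are
   vectors of V. *)
Definition coroot (R : realType) (V : vectType R) (ip : {dot V for (@idfun R)})
  (a : V) : V := (2 / ip a a) *: a.

Record is_reduced_root_system (R : realType) (V : vectType R)
    (ip : {dot V for (@idfun R)}) (Delta : set V) : Prop := {
  root_finite : finite_set Delta;
  root_span : forall U : {vspace V},
    (forall a, Delta a -> a \in U) -> U = fullv;
  root_neq0 : forall a, Delta a -> a != 0;
  root_refl : forall a b, Delta a -> Delta b ->
    Delta (b - ip (coroot ip a) b *: a);
  root_int : forall a b, Delta a -> Delta b ->
    ip (coroot ip a) b \is a Num.int;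
  root_reduced : forall (a : V) (c : R), Delta a -> Delta (c *: a) ->
    c = 1 \/ c = -1 }.

Definition pos_roots (R : realType) (V : vectType R) (r : nat)
  (Delta : set V) (alpha : r.-tuple V) : set V :=
  [set b | Delta b /\
    exists c : 'I_r -> nat, b = \sum_(i < r) tnth alpha i *+ c i].

Definition neg_roots (R : realType) (V : vectType R) (r : nat)
  (Delta : set V) (alpha : r.-tuple V) : set V :=
  [set b | Delta b /\
    exists c : 'I_r -> nat, b = - (\sum_(i < r) tnth alpha i *+ c i)].

Record is_fundamental_system (R : realType) (V : vectType R) (r : nat)
    (Delta : set V) (alpha : r.-tuple V) : Prop := {
  fund_basis : basis_of fullv alpha;
  fund_root : forall i, Delta (tnth alpha i);
  fund_sign : Delta `<=` pos_roots Delta alpha `|` neg_roots Delta alpha }.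

Definition is_fundamental_weights (R : realType) (V : vectType R)
  (ip : {dot V for (@idfun R)}) (r : nat) (alpha lam : r.-tuple V) : Prop :=
  forall i j : 'I_r, ip (coroot ip (tnth alpha i)) (tnth lam j) = (i == j)%:R.

Definition weight_lattice (R : realType) (V : vectType R) (r : nat)
  (lam : r.-tuple V) : set V :=
  [set mu | exists m : 'I_r -> int, mu = \sum_(j < r) tnth lam j *~ m j].

Definition Aut (R : realType) (V : vectType R) (Delta : set V) : set 'End(V) :=
  [set w | lker w = 0%VS /\ w @` Delta = Delta].

Definition inversion_set (R : realType) (V : vectType R) (r : nat)
  (Delta : set V) (alpha : r.-tuple V) (w : 'End(V)) : set V :=
  pos_roots Delta alpha `&` (w^-1)%VF @` neg_roots Delta alpha.

(* A family indexed by Delta / {+1, -1} is a function on V that is even on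
   Delta; its values outside Delta are irrelevant. *)
Definition is_root_family (R : realType) (V : vectType R) (Delta : set V)
  (s : V -> R[i]) : Prop := forall a, Delta a -> s (- a) = s a.

Definition region_S (R : realType) (V : vectType R) (r : nat)
  (Delta : set V) (alpha : r.-tuple V) : set (V -> R[i]) :=
  [set s | is_root_family Delta s /\
    forall a, pos_roots Delta alpha a -> 1 < complex.Re (s a)].

Definition act_family (R : realType) (V : vectType R) (w : 'End(V))
  (s : V -> R[i]) : V -> R[i] := fun a => s ((w^-1)%VF a).

Definition act_fun (R : realType) (V : vectType R) (w : 'End(V))
  (f : (V -> R[i]) -> V -> R[i]) : (V -> R[i]) -> V -> R[i] :=
  fun s y => f (act_family (w^-1)%VF s) ((w^-1)%VF y).

Definition cexp (R : realType) (z : R[i]) : R[i] :=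
  (expR (complex.Re z))%:C * (cos (complex.Im z) +i* sin (complex.Im z)).

(* x ^ s for a nonzero real x, on the branch of the logarithm where every
   negative real has argument (2k + 1) pi; k = 0 is the choice arg = pi. *)
Definition cpow (R : realType) (k : int) (x : R) (s : R[i]) : R[i] :=
  cexp (s * (ln `|x| +i* (if x < 0 then pi *~ (2 * k + 1) else 0))).

Definition hyperplanes (R : realType) (V : vectType R)
  (ip : {dot V for (@idfun R)}) (r : nat) (Delta : set V)
  (lam : r.-tuple V) : set V :=
  [set mu | weight_lattice lam mu /\
    exists2 a, Delta a & ip (coroot ip a) mu = 0].

Definition lattice_term (R : realType) (V : vectType R)
  (ip : {dot V for (@idfun R)}) (r : nat) (Delta : set V)
  (alpha : r.-tuple V) (k : int) (s : V -> R[i]) (y mu : V) : R[i] :=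
  cexp (0 +i* (2 * pi * ip y mu)) *
  \big[*%R/1]_(a \in pos_roots Delta alpha) (cpow k (ip (coroot ip a) mu) (s a))^-1.

(* [summability.sum] is the unordered sum, i.e. the limit of the finite partial
   sums along the directed set of finite subsets of V. *)
Definition lattice_sum (R : realType) (V : vectType R)
  (ip : {dot V for (@idfun R)}) (r : nat) (Delta : set V)
  (alpha lam : r.-tuple V) (k : int) (s : V -> R[i]) (y : V) : R[i] :=
  summability.sum (fun mu : V =>
    (if mu \in weight_lattice lam `\` hyperplanes ip Delta lam
     then lattice_term ip Delta alpha k s y mu else 0) : R[i]^o).

(* Main.v *)
(* The substitution mu |-> w mu in the sum turns the factor of a positive root a
   into the factor of the root w a. Up to sign, w permutes the positive roots,
   and the sign changes exactly on the inversion set of w^-1, where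
   (- x) ^ (- s) = (-1) ^ (- s) x ^ (- s) because s is an integer. The
   substitution is legitimate because w preserves the weight lattice: every
   coroot is an integral combination of simple coroots (induction on the height),
   so the lattice consists of the vectors pairing integrally with all coroots. *)

Require Import Defs.
From HB Require Import structures.
From mathcomp Require Import all_boot all_order all_algebra sesquilinear complex.
From mathcomp Require Import all_classical all_reals all_analysis.
From mathcomp Require Import ring.

Set Implicit Arguments.
Unset Strict Implicit.
Unset Printing Implicit Defensive.

Import Order.TTheory GRing.Theory Num.Theory.
Import numFieldNormedType.Exports.

Local Open Scope classical_set_scope.
Local Open Scope complex_scope.
Local Open Scope ring_scope.

(** * Reindexing and scaling of unordered sums *)

Section UnorderedSum.
Import finmap.
Local Existing Instance summability.totally_filter.

(** Taking images under [h] is an inclusion-preserving bijection between finite subsets, with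
    inverse given by [g], so eventual properties correspond. *)
Lemma totally_image (I J : choiceType) (h : I -> J) (g : J -> I) :
  cancel h g -> cancel g h ->
  (fun A : {fset I} => [fset h x | x in A]%fset) @ summability.totally =
  summability.totally.
Proof.
move=> hK gK; have img (A : {fset J}) : [fset h x | x in [fset g y | y in A]]%fset = A.
  apply/fsetP => y; apply/imfsetP/idP => [[x /imfsetP[z zA ->] ->]|yA].
    by rewrite gK.
  by exists (g y); rewrite ?gK // in_imfset.
have img' (A : {fset I}) : [fset g y | y in [fset h x | x in A]]%fset = A.
  apply/fsetP => x; apply/imfsetP/idP => [[y /imfsetP[z zA ->] ->]|xA].
    by rewrite hK.
  by exists (h x); rewrite ?hK // in_imfset.
apply/seteqP; split=> P [A _ AP].
  exists [fset h x | x in A]%fset => // B /= AB; rewrite -(img B); apply: AP => /=.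
  by rewrite -(img' A); apply/subset_imfset/fsubsetP.
exists [fset g y | y in A]%fset => // B /= AB; apply: AP => /=.
by rewrite -(img A); apply/subset_imfset/fsubsetP.
Qed.

(** The partial sum of [f \o h] over [A] is that of [f] over the image of [A], so both sides are
    limits along the same filter, convergent or not. *)
Lemma sum_reindex (I J : choiceType) (K : numDomainType) (E : normedModType K)
    (h : I -> J) (g : J -> I) (f : J -> E) :
  cancel h g -> cancel g h ->
  summability.sum f = summability.sum (f \o h).
Proof.
move=> hK gK; rewrite /summability.sum -(totally_image hK gK).
have -> // : summability.partial_sum (f \o h) =
    summability.partial_sum f \o (fun A : {fset I} => [fset h x | x in A]%fset).
apply/funext => A; rewrite /= /summability.partial_sum.
rewrite -(big_seq_fsetE _ _ xpredT f) -(big_seq_fsetE _ _ xpredT (f \o h)) /=.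
by rewrite big_imfset //= => x y _ _; apply: (can_inj hK).
Qed.

(* No convergence is assumed: the sum of a divergent family is [point] = 0. *)
Lemma sumMl (I : choiceType) (K : numFieldType) (c : K) (f : I -> K^o) :
  summability.sum (fun i => c * f i : K^o) = c * summability.sum f.
Proof.
pose S (u : I -> K^o) := summability.partial_sum u @ summability.totally.
have cvgS (d : K) (u : I -> K^o) l :
    S u --> l -> S (fun i => d * u i) --> (d * l : K^o).
  move=> ul; rewrite /S; have -> : summability.partial_sum (fun i => d * u i : K^o) =
      (fun A => d * summability.partial_sum u A).
    by apply/funext => A; rewrite /summability.partial_sum mulr_sumr.
  exact: cvgMl_tmp.
have limE (u : I -> K^o) (l : K^o) : S u --> l -> summability.sum u = l.
  by move=> ul; apply: cvg_lim => //; exact: norm_hausdorff.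
have [/cvgS fc|fd] := pselect (cvg (S f)); first exact/limE/fc.
have [->|c0] := eqVneq c 0.
  rewrite mul0r; apply: limE; rewrite /S.
  rewrite [X in X @ _](_ : _ = fun=> 0); first exact: cvg_cst.
  by apply/funext => A; rewrite /summability.partial_sum big1// => i; rewrite mul0r.
have -> : summability.sum f = 0 by rewrite /summability.sum; exact: dvgP.
rewrite mulr0.
(* For [c] nonzero, scaling back by [c^-1] shows that the scaled family diverges too. *)
apply: dvgP => /(cvgS c^-1) cfc; apply: fd; apply: cvgP; move: cfc.
by under [X in S X]eq_fun do rewrite mulKf//; exact.
Qed.

End UnorderedSum.

(** * The exponential and complex powers on a fixed branch *)

Section ComplexPower.
Variable R : realType.
Implicit Types (x t : R) (z : R[i]).

Lemma cexpD z1 z2 : cexp (z1 + z2) = cexp z1 * cexp z2.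
Proof.
case: z1 z2 => [a b] [c d]; rewrite /cexp /= expRD cosD sinD rmorphM/=.
rewrite mulrACA; congr (_ * _); simpc; congr (_ +i* _).
by rewrite addrC.
Qed.

Lemma cexp0 : cexp 0 = 1 :> R[i].
Proof. by rewrite /cexp /= expR0 cos0 sin0 mul1r. Qed.

Lemma cexp_neq0 z : cexp z != 0.
Proof.
apply/eqP => z0; have := cexpD z (- z).
by rewrite subrr cexp0 z0 mul0r => /eqP; rewrite oner_eq0.
Qed.

Lemma cexpN z : cexp (- z) = (cexp z)^-1.
Proof.
by apply: (mulfI (cexp_neq0 z)); rewrite -cexpD subrr cexp0 divff ?cexp_neq0.
Qed.

Lemma cexpMn z n : cexp (z *+ n) = cexp z ^+ n.
Proof. by elim: n => [|n IH]; rewrite ?cexp0 // mulrS cexpD exprS IH. Qed.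

Lemma cexpMz z (n : int) : cexp (z *~ n) = cexp z ^ n.
Proof. by case: n => n; rewrite ?NegzE ?mulrNz ?cexpN -pmulrn cexpMn // -exprN. Qed.

Lemma cexp_2ipi (n : int) : cexp ((0 +i* (pi *+ 2)) *~ n) = 1 :> R[i].
Proof. by rewrite cexpMz /cexp /= expR0 cos2pi sin2pi mul1r exp1rz. Qed.

Lemma im_mulrz x (n : int) : 0 +i* (x *~ n) = (0 +i* x) *~ n.
Proof.
have imMn m : 0 +i* (x *+ m) = (0 +i* x) *+ m.
  by elim: m => [|m IH]; rewrite ?mulr0n // !mulrS -IH; simpc.
by case: n => n; rewrite ?NegzE ?mulrNz -?pmulrn -imMn //; simpc.
Qed.

(* Moving the sign out changes the value by a power of [(-1) ^ (2 s)], which is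
   1 because the exponent is an integer. *)
Lemma cpowN (k : int) x (m : int) : x != 0 ->
  (cpow k (- x) m%:~R)^-1 = cpow k (-1) (- m%:~R) * (cpow k x m%:~R)^-1.
Proof.
move=> x0; rewrite /cpow !normrN (normr1 R) ln1 ltrN10 oppr_lt0.
set t := pi *~ _; set l := ln _.
have split_log : l +i* t = l +i* 0 + 0 +i* t by simpc.
have sqr1 : cexp (m%:~R * (0 +i* t)) * cexp (m%:~R * (0 +i* t)) = 1.
  rewrite -cexpD -mulrDr mulrzl [_ + _](_ : _ = (0 +i* (pi *+ 2)) *~ (2 * k + 1)).
    by rewrite -mulrzA cexp_2ipi.
  by rewrite -im_mulrz mulr2n mulrzDl -/t; simpc.
have [xp|xn|/eqP] := ltgtP 0 x; last by rewrite eq_sym (negbTE x0).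
  by rewrite split_log mulrDr cexpD invfM mulrC mulNr cexpN.
(* Now [x] is negative and carries the argument factor [B] itself; since [B] has square 1, the two
   copies of its inverse cancel. *)
have inv_sqr1 (A B : R[i]) : B * B = 1 -> A^-1 = B^-1 * (A * B)^-1.
  by move=> BB; rewrite invfM mulrCA -invfM BB invr1 mulr1.
rewrite split_log [in RHS]mulrDr cexpD mulNr cexpN.
exact: inv_sqr1.
Qed.

End ComplexPower.

(** * Coroots and reflections *)

Section RootSystem.
Variables (R : realType) (V : vectType R) (ip : {dot V for (@idfun R)}).
Implicit Types a b x y : V.

Lemma ipC x y : ip x y = ip y x.
Proof. by rewrite hermitian_subproof expr0 mul1r. Qed.

Lemma ip_gt0 x : x != 0 -> 0 < ip x x.
Proof. exact: neq0_dnorm_gt0. Qed.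

Lemma ipZl c x y : ip (c *: x) y = c * ip x y.
Proof. exact: linearZl_LR. Qed.

Lemma ipZr c x y : ip x (c *: y) = c * ip x y.
Proof. by rewrite ipC ipZl ipC. Qed.

Lemma ip_coroot a x : ip (coroot ip a) x = 2 / ip a a * ip a x.
Proof. exact: ipZl. Qed.

Lemma corootN a : coroot ip (- a) = - coroot ip a.
Proof. by rewrite /coroot linearNl linearNr opprK scalerN. Qed.

Lemma ip_coroot_self a : a != 0 -> ip (coroot ip a) a = 2.
Proof. by move=> a0; rewrite ip_coroot divfK // gt_eqF // ip_gt0. Qed.

(** The reflection in [a] is an isometry, hence commutes with taking coroots. Written with the
    coroot of [a], this drives the induction on the height. *)
Lemma coroot_reflection a b : a != 0 -> b != 0 ->
  coroot ip (b - ip (coroot ip a) b *: a) =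
  coroot ip b - ip (coroot ip b) a *: coroot ip a.
Proof.
move=> a0 b0; set n := ip (coroot ip a) b.
have aa0 : ip a a != 0 by rewrite gt_eqF // ip_gt0.
have bb0 : ip b b != 0 by rewrite gt_eqF // ip_gt0.
have nE : n = 2 / ip a a * ip a b by rewrite /n ip_coroot.
rewrite {1}/coroot.
have -> : ip (b - n *: a) (b - n *: a) = ip b b.
  rewrite linearBl !linearBr /= !ipZl !ipZr nE.
  by rewrite (ipC b a); field; rewrite aa0.
rewrite scalerBr scalerA /coroot ipZl scalerA nE (ipC b a); congr (_ - _ *: _).
by field; rewrite aa0 bb0.
Qed.

(** * Positive roots, integrality of coroots and the weight lattice *)

Variables (Delta : set V) (r : nat) (alpha lam : r.-tuple V).
Hypotheses (hDelta : is_reduced_root_system ip Delta)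
  (halpha : is_fundamental_system Delta alpha)
  (hlam : is_fundamental_weights ip alpha lam).

(** The reflection in [a] sends [a] to its opposite. *)
Lemma rootN a : Delta a -> Delta (- a).
Proof.
move=> Da; have := root_refl hDelta Da Da; rewrite ip_coroot_self ?(root_neq0 hDelta)//.
by rewrite scaler_nat mulr2n opprD addNKr.
Qed.

Lemma simple_root_neq0 i : tnth alpha i != 0.
Proof. exact/(root_neq0 hDelta)/(fund_root halpha). Qed.

Lemma simple_root_free (c d : 'I_r -> R) :
  \sum_(i < r) c i *: tnth alpha i = \sum_(i < r) d i *: tnth alpha i -> c =1 d.
Proof.
have fa := basis_free (fund_basis halpha).
have tnthE (e : 'I_r -> R) :
    \sum_(i < r) e i *: tnth alpha i = \sum_(i < r) e i *: alpha`_i.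
  by apply: eq_bigr => i _; rewrite (tnth_nth 0).
by rewrite !tnthE => + i => /(congr1 (coord alpha i)); rewrite !coord_sum_free.
Qed.

(** Expanding one argument of [ip x x] in the basis of simple roots gives 0, and [ip] is
    definite. *)
Lemma orthogonal_coroots_eq0 x :
  (forall i, ip (coroot ip (tnth alpha i)) x = 0) -> x = 0.
Proof.
move=> x_orth; apply/eqP/negPn/negP => /ip_gt0.
rewrite {1}(coord_basis (fund_basis halpha) (memvf x)).
rewrite linear_sumlz big1 ?ltxx // => i _.
apply: etrans (ipZl _ _ _) _.
have := x_orth i; rewrite ip_coroot (tnth_nth 0) => /eqP; rewrite mulf_eq0.
have := simple_root_neq0 i; rewrite (tnth_nth 0) => /ip_gt0 /gt_eqF ii0.
by rewrite mulf_eq0 invr_eq0 ii0 pnatr_eq0 /= => /eqP ->; rewrite mulr0.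
Qed.

Lemma pos_rootsE b : pos_roots Delta alpha b <-> neg_roots Delta alpha (- b).
Proof.
split=> -[Db [c bE]]; split.
- exact: rootN.
- by exists c; rewrite bE.
- by rewrite -[b]opprK; exact: rootN.
- by exists c; apply: oppr_inj.
Qed.

(** Two such expansions would have [c + d = 0] with natural coefficients, forcing [b = 0]. *)
Lemma pos_neg_roots_disjoint b : pos_roots Delta alpha b -> ~ neg_roots Delta alpha b.
Proof.
move=> [Db [c bE]] [_ [d bE']]; move/eqP: (root_neq0 hDelta Db); apply.
have cd i : ((c i)%:R + (d i)%:R : R) = 0.
  apply: (@simple_root_free (fun i => (c i)%:R + (d i)%:R) (fun=> 0)).
  under eq_bigr do rewrite scalerDl !scaler_nat.
  rewrite big_split /= -bE -[X in _ + X]opprK -bE' subrr big1 // => j _.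
  exact: scale0r.
rewrite bE big1 // => i _; move/eqP: (cd i); rewrite -natrD pnatr_eq0 addn_eq0.
by move=> /andP[/eqP -> _].
Qed.

(** Otherwise [ip b b], a nonnegative combination of pairings with simple roots, would be at most 0.
    The index found gives a simple reflection that lowers the height. *)
Lemma pos_root_ip_gt0 (b : V) (c : 'I_r -> nat) : b != 0 ->
  b = \sum_(i < r) tnth alpha i *+ c i ->
  exists i : 'I_r, 0 < ip (coroot ip (tnth alpha i)) b.
Proof.
move=> b0 bE; apply: contrapT => /forallNP h; have := ip_gt0 b0.
rewrite {1}bE linear_sumlz ltNge sumr_le0 // => i _; rewrite linearMnl mulrn_wle0 //.
have /negP := h i; rewrite -leNgt ip_coroot pmulr_rle0 //.
by rewrite divr_gt0 // ip_gt0 // simple_root_neq0.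
Qed.

(** For a positive root [b], reflect in a simple root with positive pairing: the coroot of [b] is
    that of a lower positive root plus an integral multiple of a simple coroot. *)
Lemma ip_coroot_int x :
  (forall i, ip (coroot ip (tnth alpha i)) x \is a Num.int) ->
  forall b, Delta b -> ip (coroot ip b) x \is a Num.int.
Proof.
move=> x_int.
suff posP b : pos_roots Delta alpha b -> ip (coroot ip b) x \is a Num.int.
  move=> b /(fund_sign halpha)[/posP//|nb]; rewrite -[b]opprK corootN linearNl rpredN.
  by apply/posP/pos_rootsE; rewrite opprK.
move=> [Db [c]]; have [n] := ubnP (\sum_i c i)%N.
elim: n => // n IH in b c Db *; rewrite ltnS => cn bE.
have b0 := root_neq0 hDelta Db.
have [i m0] := pos_root_ip_gt0 b0 bE.
set m := ip (coroot ip (tnth alpha i)) b in m0.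
have Di := fund_root halpha i; have i0 := simple_root_neq0 i.
have Db' := root_refl hDelta Di Db; rewrite -/m in Db'.
have [single|[j ji cj]] :
    (forall j, j != i -> c j = 0%N) \/ (exists2 j, j != i & c j != 0%N).
  have [|/existsNP[j /not_implyP[ji /eqP cj]]] :=
    pselect (forall j, j != i -> c j = 0%N); first by left.
  by right; exists j.
  (* A root proportional to a simple root is that simple root, by reducedness and the sign of
     [c i]. *)
  have {}bE : b = (c i)%:R *: tnth alpha i.
    rewrite bE (bigD1 i) //= big1 ?addr0 ?scaler_nat // => j ji.
    by rewrite single // mulr0n.
  rewrite bE in Db; rewrite bE; have [->|c1] := root_reduced hDelta Di Db.
    by rewrite scale1r.
  by have := ler0n R (c i); rewrite c1 ler0N1.
suff b'_int : ip (coroot ip (b - m *: tnth alpha i)) x \is a Num.int.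
  have -> : ip (coroot ip b) x = ip (coroot ip (b - m *: tnth alpha i)) x +
      ip (coroot ip b) (tnth alpha i) * ip (coroot ip (tnth alpha i)) x.
    by rewrite coroot_reflection // linearBl /= [ip (_ *: coroot _ _) x]ipZl subrK.
  exact: rpredD b'_int (rpredM (root_int hDelta Db Di) (x_int i)).
have coordE (d : 'I_r -> R) :
    b - m *: tnth alpha i = \sum_(l < r) d l *: tnth alpha l ->
    forall l, (c l)%:R = d l + (if l == i then m else 0).
  move=> dE l; apply: (@simple_root_free (fun l => (c l)%:R)
    (fun l => d l + (if l == i then m else 0))).
  under eq_bigr do rewrite scaler_nat.
  under [RHS]eq_bigr do rewrite scalerDl.
  rewrite -bE big_split -dE /= [X in _ + X](bigD1 i) //= eqxx.
  rewrite [X in _ + (_ + X)]big1 ?addr0 ?subrK //.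
  by move=> l' /negbTE ->; rewrite scale0r.
have [[_ [d dE]]|[_ [d dE]]] := fund_sign halpha Db'.
  have cE := coordE (fun l => (d l)%:R).
  have {}cE l : (c l)%:R = (d l)%:R + (if l == i then m else 0) :> R.
    by apply: cE; rewrite dE; apply: eq_bigr => l' _; rewrite scaler_nat.
  (* Only the coordinate at [i] changes, and it drops by [m > 0]. *)
  apply: (IH _ d Db' _ dE); apply: leq_trans cn.
  rewrite (bigD1 i) // [ltnRHS](bigD1 i) //=.
  rewrite -addSn; apply: leq_add; first by rewrite -(ltr_nat R) cE eqxx ltrDl.
  by apply: leq_sum => l li; rewrite -(ler_nat R) cE (negbTE li) addr0.
(* The reflected root cannot be negative: it keeps the positive coordinate of [b] at [j]. *)
have cE : (c j)%:R = - (d j)%:R + (if j == i then m else 0) :> R.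
  apply: (coordE (fun l => - (d l)%:R)); rewrite dE -sumrN.
  by apply: eq_bigr => l' _; rewrite scaleNr scaler_nat.
have : (0 : R) < (c j)%:R by rewrite ltr0n lt0n.
by rewrite cE (negbTE ji) addr0 oppr_gt0 ltNge ler0n.
Qed.

(** By duality, the pairings with simple coroots are the coordinates in the fundamental weights. *)
Lemma weight_latticeP x :
  weight_lattice lam x <->
  forall i, ip (coroot ip (tnth alpha i)) x \is a Num.int.
Proof.
have pairing (m : 'I_r -> int) i :
    ip (coroot ip (tnth alpha i)) (\sum_(j < r) tnth lam j *~ m j) = (m i)%:~R.
  rewrite raddf_sum /= (bigD1 i) //= big1 ?addr0 => [|j ji].
    by rewrite -scaler_int ipZr hlam eqxx mulr1.
  by rewrite -scaler_int ipZr hlam eq_sym (negbTE ji) mulr0.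
split=> [[m ->] i|x_int]; first by rewrite pairing rpred_int.
exists (fun i => Num.floor (ip (coroot ip (tnth alpha i)) x)).
apply/eqP; rewrite -subr_eq0; apply/eqP/orthogonal_coroots_eq0 => i.
by rewrite linearBr /= pairing floorK ?subrr.
Qed.

(** * Automorphisms acting on roots and weights *)

Lemma Aut_can w : Aut Delta w -> cancel w (w^-1)%VF.
Proof. by move=> [/eqP k0 _]; exact: lker0_lfunK. Qed.

Lemma Aut_inv_can w : Aut Delta w -> cancel (w^-1)%VF w.
Proof. by move=> [/eqP k0 _]; exact: lker0_lfunVK. Qed.

Lemma Aut_root w a : Aut Delta w -> Delta a -> Delta (w a).
Proof. by move=> [_ wD] Da; rewrite -wD; exists a. Qed.

Lemma Aut_inv w : Aut Delta w -> Aut Delta (w^-1)%VF.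
Proof.
move=> hw; have wK := Aut_can hw; have w'K := Aut_inv_can hw; split.
  by apply/eqP/lker0P; exact: can_inj w'K.
have [_ wD] := hw; rewrite -[in LHS]wD; apply/seteqP; split=> [_ [_ [a Da <-] <-]|a Da].
  by rewrite wK.
by exists (w a); [exists a|exact: wK].
Qed.

Lemma Aut_invK w : Aut Delta w -> (w^-1)^-1%VF = w.
Proof.
move=> hw; apply/lfunP => x; apply: (can_inj (Aut_inv_can hw)).
by rewrite (Aut_can hw) (Aut_inv_can (Aut_inv hw)).
Qed.

Hypothesis hip : forall w, Aut Delta w -> forall x y, ip (w x) (w y) = ip x y.

Lemma ip_coroot_Aut w a x : Aut Delta w ->
  ip (coroot ip (w a)) (w x) = ip (coroot ip a) x.
Proof. by move=> hw; rewrite !ip_coroot !hip. Qed.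

(** Moving [w] across the pairing replaces a simple root by its image under [w^-1], which need not
    be simple; hence the need for integrality on all coroots. *)
Lemma weight_lattice_Aut w x : Aut Delta w ->
  weight_lattice lam x -> weight_lattice lam (w x).
Proof.
move=> hw /weight_latticeP x_int; apply/weight_latticeP => i.
rewrite -[tnth alpha i](Aut_inv_can hw) ip_coroot_Aut //.
by apply: ip_coroot_int x_int _ _; apply/(Aut_root (Aut_inv hw))/(fund_root halpha).
Qed.

Lemma regular_weight_Aut w x : Aut Delta w ->
  (weight_lattice lam `\` hyperplanes ip Delta lam) (w x) <->
  (weight_lattice lam `\` hyperplanes ip Delta lam) x.
Proof.
have imp u z : Aut Delta u -> (weight_lattice lam `\` hyperplanes ip Delta lam) z ->
    (weight_lattice lam `\` hyperplanes ip Delta lam) (u z).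
  move=> hu [Pz nHz]; split; first exact: weight_lattice_Aut.
  move=> [_ [a Da a0]]; apply: nHz; split=> //.
  exists ((u^-1)%VF a); first exact: Aut_root (Aut_inv hu) Da.
  by rewrite -(ip_coroot_Aut _ _ hu) (Aut_inv_can hu).
move=> hw; split=> [|/(imp _ _ hw)//].
by move/(imp _ _ (Aut_inv hw)); rewrite (Aut_can hw).
Qed.

(* [w] permutes the positive roots up to sign, and [inversion_set w^-1]
   consists of the positive roots [b] such that [- b] is the image under [w]
   of a positive root. *)
Lemma prod_pos_roots_Aut (K : comNzRingType) (F C : V -> K) w : Aut Delta w ->
  (forall b, inversion_set Delta alpha (w^-1)%VF b -> F (- b) = C b * F b) ->
  \big[*%R/1]_(a \in pos_roots Delta alpha) F (w a) =
  (\big[*%R/1]_(a \in inversion_set Delta alpha (w^-1)%VF) C a) *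
  \big[*%R/1]_(a \in pos_roots Delta alpha) F a.
Proof.
move=> hw FN; pose pos := pos_roots Delta alpha.
have fin_pos : finite_set pos by apply: sub_finite_set (root_finite hDelta) => a [].
have posVneg a : Delta a -> pos a \/ pos (- a).
  move=> /(fund_sign halpha)[|na]; [by left|right].
  by apply/pos_rootsE; rewrite opprK.
have posN a : pos a -> ~ pos (- a).
  by move=> pa /pos_rootsE; rewrite opprK; exact: pos_neg_roots_disjoint.
have wpos a : pos a -> Delta (w a) by move=> [Da _]; exact: Aut_root.
(* The positive one among [w a] and [- w a]. *)
pose sigma a := if w a \in pos then w a else - w a.
have sigma_bij : set_bij pos pos sigma.
  split.
  - move=> a pa; rewrite /sigma; case: ifPn => [/set_mem//|/negP nwa].
    by case: (posVneg _ (wpos _ pa)) => // /mem_set.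
  - move=> a b /set_mem pa /set_mem pb.
    have w_inj := can_inj (Aut_can hw).
    (* In the mixed cases [w a = - w b] would make [a] and [b] opposite positive roots. *)
    have absurd z : pos z -> pos (- z) -> a = b by move=> /posN.
    rewrite /sigma; case: ifP => _; case: ifP => _.
    + exact: w_inj.
    + by rewrite -linearN => /w_inj ab; apply: (absurd b); rewrite -?ab.
    + by rewrite -linearN => /w_inj ab; apply: (absurd a); rewrite ?ab.
    + by move=> /oppr_inj /w_inj.
  - move=> b pb; have [Db _] := pb.
    have wE z : w ((w^-1)%VF z) = z := Aut_inv_can hw z.
    have [pa|pa] := posVneg _ (Aut_root (Aut_inv hw) Db).
      by exists ((w^-1)%VF b) => //; rewrite /sigma wE mem_set.
    exists (- (w^-1)%VF b) => //; rewrite /sigma linearN /= wE opprK ifN //.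
    by apply/negP => /set_mem; exact: posN.
(* Extending the product of [C] by 1 to all positive roots lets both products merge and be reindexed
   by [sigma]. *)
rewrite /inversion_set Aut_invK // [X in X * _]fsbig_mkcondr.
rewrite -[RHS](fsbig_split [the Monoid.com_law 1 of *%R] _ _ fin_pos) /=.
rewrite [RHS](reindex_fsbig _ _ _ _ sigma_bij); apply: eq_fsbigr => a /set_mem pa /=.
rewrite /sigma; have [/set_mem pwa|/negP nwa] := boolP (w a \in pos).
  have /negbTE -> : w a \notin w @` neg_roots Delta alpha.
    apply/negP => /set_mem[n neg_n /(can_inj (Aut_can hw)) na].
    by apply: (pos_neg_roots_disjoint pa); rewrite -na.
  by rewrite mul1r.
have inv_wa : (w @` neg_roots Delta alpha) (- w a).
  by exists (- a); [apply/pos_rootsE|rewrite linearN].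
rewrite mem_set // -FN ?opprK //; split; last by rewrite Aut_invK.
by case: (posVneg _ (wpos _ pa)) => // /mem_set.
Qed.

End RootSystem.

(** * Termwise comparison of the two lattice sums *)

Theorem theorem5p1 (R : realType) (V : vectType R)
  (ip : {dot V for (@idfun R)}) (r : nat) (Delta : set V)
  (alpha lam : r.-tuple V) (k : int)
  (hDelta : is_reduced_root_system ip Delta)
  (halpha : is_fundamental_system Delta alpha)
  (hlam : is_fundamental_weights ip alpha lam)
  (hip : forall w, Aut Delta w -> forall x y, ip (w x) (w y) = ip x y)
  (s : V -> R[i]) (y : V) (w : 'End(V))
  (hs : region_S Delta alpha s)
  (hw : Aut Delta w)
  (hint : forall a, inversion_set Delta alpha (w^-1)%VF a ->
            exists m : int, s a = m%:~R) :
  act_fun w (lattice_sum ip Delta alpha lam k) s y =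
  (\big[*%R/1]_(a \in inversion_set Delta alpha (w^-1)%VF)
      cpow k (-1) (- s a)) *
  lattice_sum ip Delta alpha lam k s y.
Proof.
rewrite /act_fun /lattice_sum.
rewrite [in RHS](sum_reindex _ (Aut_can hw) (Aut_inv_can hw)).
apply: etrans (sumMl _ _); congr (summability.sum _); apply/funext => mu /=.
have reg_iff := regular_weight_Aut hDelta halpha hlam hip mu hw.
have regE : (w mu \in weight_lattice lam `\` hyperplanes ip Delta lam) =
            (mu \in weight_lattice lam `\` hyperplanes ip Delta lam).
  by apply/idP/idP => /set_mem/reg_iff/mem_set.
rewrite regE; case: ifPn => [/set_mem/reg_iff[wmu_wt wmu_reg]|_]; last by rewrite mulr0.
rewrite /lattice_term mulrCA -[in ip y _](Aut_inv_can hw y) (hip _ hw); congr (_ * _).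
(* With the weight fixed at [w mu], the factor of [a] on the left is [F (w a)], by invariance of
   [ip]. *)
pose F b := (cpow k (ip (coroot ip b) (w mu)) (s b))^-1.
rewrite -(prod_pos_roots_Aut hDelta halpha (F := F) hw) => [|b ib].
  apply: eq_fsbigr => a _.
  by rewrite /F /act_family (Aut_invK hw) (ip_coroot_Aut hip _ _ hw).
have [[Db pb] _] := ib; have [m sb] := hint b ib.
rewrite /F corootN linearNl (hs.1 _ Db) sb cpowN //.
(* The base of the power is nonzero because [w mu] lies on no hyperplane. *)
by apply/eqP => b0; apply: wmu_reg; split=> //; exists b.
Qed.
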